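(* For every $F\in\mathsf{For}$ and every $i\ge 1$, the polynomial $\mathsf{R}_i\,\mathfrak{P}_F$ is multiplicity-free forest positive.
   Context: $\mathbb{N}=\{1,2,\ldots\}$ and $\mathrm{Pol}=\mathbb{Z}[x_1,x_2,\ldots]$. For $i\ge 1$ and $f\in\mathrm{Pol}$, $\mathsf{R}_i(f)=f(x_1,\ldots,x_{i-1},0,x_i,x_{i+1},\ldots)$. Forests: a binary tree is a finite rooted plane tree in which each node is either a leaf (no children) or internal, having an ordered pair of children $v_L,v_R$; $\ast$ is the tree with a single node (a leaf). An indexed forest is an infinite sequence $F=(T_1,T_2,\ldots)$ of binary trees, all but finitely many equal to $\ast$; $\mathsf{For}$ is the set of indexed forests. The leaves of $F$, read from left to right, are identified with $1,2,3,\ldots$. $\mathrm{IN}(F)$ is the finite set of internal nodes. For $v\in \mathrm{IN}(F)$, $\rho_F(v)\in\mathbb{N}$ is the leaf reached from $v$ by repeatedly passing to the left child. Forest polynomials: let $\mathcal{C}(F)$ be the set of $\kappa:\mathrm{IN}(F)\to\mathbb{N}$ such that for all $v\in \mathrm{IN}(F)$: $\kappa(v)\le\rho_F(v)$; if $v_L\in \mathrm{IN}(F)$ then $\kappa(v)\le\kappa(v_L)$; if $v_R\in \mathrm{IN}(F)$ then $\kappa(v)<\kappa(v_R)$. Then $\mathfrak{P}_F=\sum_{\kappa\in\mathcal{C}(F)}\prod_{v\in \mathrm{IN}(F)}x_{\kappa(v)}$. The forest polynomials form a $\mathbb{Z}$-basis of $\mathrm{Pol}$. A polynomial $f\in\mathrm{Pol}$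 is multiplicity-free forest positive if all coefficients $a_G$ in its expansion $f=\sum_{G\in\mathsf{For}}a_G\mathfrak{P}_G$ lie in $\{0,1\}$. *)

(* Defs.v *)
From HB Require Import structures.
From mathcomp Require Import all_boot all_order all_algebra.
From mathcomp Require Import finmap.
From mathcomp.multinomials Require Import monalg.

Set Implicit Arguments.
Unset Strict Implicit.
Unset Printing Implicit Defensive.

Import GRing.Theory.
Local Open Scope ring_scope.

(* All the index sets {1, 2, 3, ...} (variables, trees of a forest, leaves,   *)
(* values of kappa, the index i of R_i) are shifted by one and represented by *)
(* nat: k : nat stands for k + 1.  The definitions only compare such indices  *)
(* with one another or pass from j > i to j - 1, so they are invariant under  *)
(* this shift.                                                                *)

Notation Pol := {malg int[{cmonom nat}]}.

Definition X (j : nat) : Pol := << ucm j >>.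

(* The ring endomorphism of Pol sending X j to s j. *)
Definition msubst (s : nat -> Pol) (f : Pol) : Pol :=
  mmap (fun c : int => c%:~R)
       (fun m : {cmonom nat} => \prod_(j <- finsupp m) s j ^+ m j) f.

Definition R_subst (i j : nat) : Pol :=
  if (j < i)%N then X j else if j == i then 0 else X j.-1.

(* Rop i is R_(i+1) with the shifted indexing. *)
Definition Rop (i : nat) (f : Pol) : Pol := msubst (R_subst i) f.

Inductive bintree := Leaf | Node of bintree & bintree.

Fixpoint bintree_encode (t : bintree) : GenTree.tree unit :=
  match t with
  | Leaf => GenTree.Leaf tt
  | Node l r => GenTree.Node 0 [:: bintree_encode l; bintree_encode r]
  end.

Fixpoint bintree_decode (t : GenTree.tree unit) : bintree :=
  match t with
  | GenTree.Node _ [:: l; r] => Node (bintree_decode l) (bintree_decode r)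
  | _ => Leaf
  end.

Lemma bintree_encodeK : cancel bintree_encode bintree_decode.
Proof. by elim=> //= l -> r ->. Qed.

HB.instance Definition _ := Countable.copy bintree (can_type bintree_encodeK).

(* A node of a tree is given by its address, the path leading to it from the  *)
(* root, where false means "left child" and true means "right child".         *)
Definition address := seq bool.

Fixpoint inodes (t : bintree) : seq address :=
  match t with
  | Leaf => [::]
  | Node l r =>
      [::] :: map (cons false) (inodes l) ++ map (cons true) (inodes r)
  end.

(* The leaves from left to right. *)
Fixpoint leaves (t : bintree) : seq address :=
  match t with
  | Leaf => [:: [::]]
  | Node l r => map (cons false) (leaves l) ++ map (cons true) (leaves r)
  end.

(* The leaf of t reached from its node p by repeatedly going left. *)
Fixpoint left_leaf (t : bintree) (p : address) : address :=
  match t, p with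
  | Leaf, _ => [::]
  | Node l _, [::] => false :: left_leaf l [::]
  | Node l _, false :: q => false :: left_leaf l q
  | Node _ r, true :: q => true :: left_leaf r q
  end.

Definition forest := {fsfun nat -> bintree with Leaf}.

(* The node (n, p) of F is the node of F n with address p. *)
Definition node : choiceType := (nat * address)%type.

Definition left_child (v : node) : node := (v.1, rcons v.2 false).
Definition right_child (v : node) : node := (v.1, rcons v.2 true).

Definition IN (F : forest) : {fset node} :=
  [fset v | v in [seq (n, p) | n <- finsupp F, p <- inodes (F n)]]%fset.

Lemma in_IN (F : forest) (v : node) : (v \in IN F) = (v.2 \in inodes (F v.1)).
Proof.
rewrite !inE /=; apply/allpairsPdep/idP => [[n [p [_ p_in ->]]] //|v_in].
exists v.1, v.2; split=> //; last by case: v {v_in}.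
by rewrite mem_finsupp; apply/eqP => vE; rewrite vE in v_in.
Qed.

(* The number of leaves of F strictly to the left of its leaf u. *)
Definition leaf_rank (F : forest) (u : node) : nat :=
  ((\sum_(m < u.1) size (leaves (F m))) + index u.2 (leaves (F u.1)))%N.

Definition rho (F : forest) (v : node) : nat :=
  leaf_rank F (v.1, left_leaf (F v.1) v.2).

Definition compatible (F : forest) (kappa : IN F -> nat) : bool :=
  [forall v : IN F,
    [&& (kappa v <= rho F (val v))%N,
        [forall w : IN F,
          (val w == left_child (val v)) ==> (kappa v <= kappa w)%N] &
        [forall w : IN F,
          (val w == right_child (val v)) ==> (kappa v < kappa w)%N]]].

(* A strict upper bound for the values of all compatible kappa (see           *)
(* compatible_lt), which makes their set a subset of a finite type.           *)
Definition rho_bound (F : forest) : nat :=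
  (\max_(v : IN F) (rho F (val v)).+1)%N.

Lemma compatible_lt (F : forest) (kappa : IN F -> nat) :
  compatible kappa -> forall v, (kappa v < rho_bound F)%N.
Proof.
move=> /forallP c v; have /and3P[le_v _ _] := c v.
by apply: leq_trans (leq_bigmax v); rewrite ltnS.
Qed.

Definition forest_poly (F : forest) : Pol :=
  \sum_(kappa : {ffun IN F -> 'I_(rho_bound F)} |
          compatible (fun v => kappa v : nat))
    \prod_(v : IN F) X (kappa v).

(* Elements of {malg int[forest]}, the free abelian group on forests, are the *)
(* finitely supported families of integer coefficients.  Such an expansion is *)
(* unique, as the forest polynomials form a basis of Pol.                     *)
Definition forest_expansion (f : Pol) (a : {malg int[forest]}) : Prop :=
  f = \sum_(G <- msupp a) a@_G *: forest_poly G.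

Definition multiplicity_free_forest_positive (f : Pol) : Prop :=
  exists2 a : {malg int[forest]},
    forest_expansion f a & forall G, a@_G \in [:: 0; 1].

(* Main.v *)
From HB Require Import structures.
From mathcomp Require Import all_boot all_algebra.
From mathcomp Require Import finmap zify.
From mathcomp.multinomials Require Import monalg.
Require Import Defs.

(** Indices start at 0, R_i stands for [Rop i] and P_F for [forest_poly F].
    The proof rests on the trimming operators

      T_j f = (R_{j+1} f - R_j f) / x_j.

    If the leaves j and j+1 of F form a cherry, that is, are the two children
    of one node, then T_j P_F = P_H, where H is F with this cherry replaced by
    a leaf; otherwise T_j P_F = 0 ([Dop_forest_poly_at]; stating this for x_j
    T_j avoids division).  Therefore, if f is the sum of the a_G P_G and G
    becomes H when its cherry at j is pruned, then a_G is the coefficient of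
    P_H in T_j f, whereas the coefficient of the empty forest is the constant
    term of f.  Every nonempty forest has a cherry, so that all coefficients
    can be read off by repeated trimming.

    For f = R_i P_F this shows that the coefficients are 0 or 1, by induction
    on G and simultaneously for all F and i, once T_j R_i P_F is known to be
    either 0 or of the form R_i' P_F' ([Dop_R_forest_poly_at]).  The
    cosimplicial identities R_i R_j = R_j R_{i+1} for j <= i give

      T_j R_i = R_i T_{j+1}                      if i <= j,
      T_j R_i = R_{i-1} T_j                      if j < i - 1,
      T_j R_i = R_i T_{i-1} + R_{i-1} T_i        if j = i - 1,

    and in the last case at most one of the two terms acts nontrivially on
    P_F, because the leaf i cannot be in a cherry with both of its neighbours.

    The formula for T_j P_F comes from factoring P_F into one polynomial per
    tree, each given by a recursion on the tree with explicit bounds for the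
    labels ([forest_poly_atE], [tree_poly_diff]); R_i merely changes the
    bounds ([R_tree_poly]).

    That an expansion exists at all is a triangularity argument: the pointwise
    largest labelling in C(F) is rho, every monomial is the monomial of rho
    for some F, and all other labellings have a smaller sum of labels
    ([forest_poly_at_lead]). *)

Set Implicit Arguments.
Unset Strict Implicit.
Unset Printing Implicit Defensive.

Import GRing.Theory.
Local Open Scope ring_scope.

(** * The operators R_i as ring morphisms *)

Definition monom_subst (s : nat -> Pol) (m : {cmonom nat}) : Pol :=
  \prod_(j <- finsupp m) s j ^+ m j.

Lemma monom_substEw s (d : {fset nat}) (m : {cmonom nat}) :
  (finsupp m `<=` d)%fset -> monom_subst s m = \prod_(j <- d) s j ^+ m j.
Proof.
move=> sub_d; rewrite /monom_subst; apply/big_fset_incl => //.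
move=> j j_d; rewrite -cmE_eq0 => /eqP->; exact: expr0.
Qed.

Lemma monom_subst_mmorphism s : mmorphism (monom_subst s).
Proof.
split=> [m1 m2|]; last by rewrite /monom_subst mdom1 big_seq_fset0.
rewrite /monom_subst mdomD.
rewrite -/(monom_subst s m1) -/(monom_subst s m2).
rewrite (monom_substEw s (fsubsetUl (finsupp m1) (finsupp m2))).
rewrite (monom_substEw s (fsubsetUr (finsupp m1) (finsupp m2))).
by rewrite -big_split; apply: eq_bigr => j _; rewrite cmM exprD.
Qed.

HB.instance Definition _ s :=
  isMultiplicative.Build _ _ (monom_subst s) (monom_subst_mmorphism s).

HB.instance Definition _ s :=
  GRing.RMorphism.copy (msubst s) (mmap (fun c : int => c%:~R) (monom_subst s)).

HB.instance Definition _ i := GRing.RMorphism.copy (Rop i) (msubst (R_subst i)).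

Lemma msubstX s j : msubst s (X j) = s j.
Proof.
have -> : msubst s (X j) = 1 * monom_subst s (ucm j) by exact: mmapU.
by rewrite mul1r /monom_subst (mdomU j) big_seq_fset1 cmUU expr1.
Qed.

Lemma RopX i j : Rop i (X j) = R_subst i j.
Proof. exact: msubstX. Qed.

Lemma RopX_lt i j : (j < i)%N -> Rop i (X j) = X j.
Proof. by rewrite RopX /R_subst => ->. Qed.

Lemma RopX_eq i : Rop i (X i) = 0.
Proof. by rewrite RopX /R_subst ltnn eqxx. Qed.

Lemma RopX_gt i j : (i <= j)%N -> Rop i (X j.+1) = X j.
Proof. by move=> le_ij; rewrite RopX /R_subst !ifN //; lia. Qed.

Definition xprod (s : seq nat) : Pol := \prod_(k <- s) X k.

Lemma monom_xprod (m : {cmonom nat}) : exists s, << m >> = xprod s.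
Proof.
have [d] := ubnP (mdeg m); elim: d m => // d IHd m; rewrite ltnS => le_m_d.
have [m0|[j j_m]] := fset_0Vmem (finsupp m).
  exists [::]; rewrite /xprod big_nil (_ : m = mone) ?mpolyC1E //.
  by apply/eqP/cmP => i; rewrite cm1; apply/eqP; rewrite cmE_eq0 m0.
have mE : m = mmul (ucm j) (divcm m (ucm j)).
  apply/eqP/cmP => i; rewrite cmM divcmE cmU; case: eqP => [<-|_].
    by rewrite subnKC // lt0n cmE_neq0.
  by rewrite subn0.
have [|s sE] := IHd (divcm m (ucm j)).
  by move: le_m_d; rewrite {1}mE mdegM mdegU.
exists (j :: s); rewrite /xprod big_cons -/(xprod s) -sE.
by rewrite /X malgM_def fgmulUU mulr1 -mE.
Qed.

Lemma Pol_ind (P : Pol -> Prop) :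
    P 0 -> (forall f g, P f -> P g -> P (f + g)) ->
    (forall c f, P f -> P (c *: f)) -> (forall s, P (xprod s)) ->
  forall f, P f.
Proof.
move=> P0 PD PZ Px f; rewrite [f]monalgE; elim/big_ind: _ => // m _.
have [s mE] := monom_xprod m.
have -> : << f@_m *g m >> = f@_m *: << m >> :> Pol.
  by rewrite malgZ_def /fgscale msuppU1 big_seq_fset1 mcoeffUU mulr1.
by rewrite mE; apply: PZ.
Qed.

(** Reduces identities between operators on polynomials to the variables. *)
Lemma rmorphism_Pol_eq (R : comNzRingType) (u v : {rmorphism Pol -> R}) :
  (forall j, u (X j) = v (X j)) -> u =1 v.
Proof.
move=> eq_uv; elim/Pol_ind => [|f g|c f|s]; rewrite ?rmorph0 ?rmorphD //.
- by move=> -> ->.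
- by rewrite -mul_malgC -[c]intz !rmorphM !rmorph_int => ->.
- by rewrite /xprod !rmorph_prod; apply: eq_bigr => j _.
Qed.

(** Multiplication by a variable is injective on monomials, so it merely moves
    the coefficients of [f] to other monomials. *)
Lemma mulX_eq0 j f : X j * f = 0 -> f = 0.
Proof.
move=> xf0; apply/malgP => m; rewrite mcoeff0.
have := congr1 (mcoeff (mmul (ucm j) m)) xf0; rewrite mcoeff0 => <-.
have mul_inj k : (mmul (ucm j) k == mmul (ucm j) m) = (k == m).
  apply/eqP/eqP => [/eqP/cmP eq_km|-> //]; apply/eqP/cmP => i.
  by have := eq_km i; rewrite !cmM => /addnI.
rewrite malgM_def fgmulUg [in LHS](monalgE f) !raddf_sum.
apply: eq_bigr => k _.
by rewrite [LHS]mcoeffU [RHS]mcoeffU mul_inj mul1r.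
Qed.

Definition ev0 : {rmorphism Pol -> int} := mcoeff mone.

Lemma ev0X j : ev0 (X j) = 0.
Proof. by rewrite /= mcoeffU1 cm1_eq1. Qed.

(** Both sides set the variables of index j and i+1 to zero and close the
    gaps: these are the cosimplicial identities, on the generators. *)
Lemma comp_shift (A : comNzRingType) (x : nat -> A)
    (R : nat -> {rmorphism A -> A}) i j k :
    (forall i j, (j < i)%N -> R i (x j) = x j) ->
    (forall i, R i (x i) = 0) ->
    (forall i j, (i <= j)%N -> R i (x j.+1) = x j) ->
    (j <= i)%N ->
  R i (R j (x k)) = R j (R i.+1 (x k)).
Proof.
move=> Rlt Req Rgt le_ji; case: k => [|k].
  case: j le_ji => [|j] le_ji; first by rewrite Req Rlt // Req rmorph0.
  by rewrite !Rlt //; lia.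
case: (ltngtP k.+1 j) => [lt_kj|lt_jk|jE]; last first.
- by subst j; rewrite (Rlt i.+1) ?Req ?rmorph0.
- rewrite Rgt //; case: (ltngtP k i) => [lt_ki|lt_ik|iE]; last first.
  + by subst i; rewrite !Req rmorph0.
  + case: k lt_jk lt_ik => // k lt_jk lt_ik.
    by rewrite !Rgt //; lia.
  + by rewrite (Rlt i.+1) ?(Rlt i) ?Rgt.
by rewrite !Rlt //; lia.
Qed.

Lemma Rop_comp i j f : (j <= i)%N -> Rop i (Rop j f) = Rop j (Rop i.+1 f).
Proof.
move=> le_ji; pose u : {rmorphism Pol -> Pol} := Rop i \o Rop j.
pose v : {rmorphism Pol -> Pol} := Rop j \o Rop i.+1.
suff eq_uv k : u (X k) = v (X k) by exact: rmorphism_Pol_eq eq_uv f.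
exact: (@comp_shift Pol X Rop i j k RopX_lt RopX_eq RopX_gt le_ji).
Qed.

Lemma ev0_Rop i f : ev0 (Rop i f) = ev0 f.
Proof.
pose u : {rmorphism Pol -> int} := ev0 \o Rop i.
suff eq_u k : u (X k) = ev0 (X k) by exact: rmorphism_Pol_eq eq_u f.
rewrite -[u _]/(ev0 (Rop i (X k))) (ev0X k).
have [lt_ki|lt_ik|->] := ltngtP k i; first by rewrite RopX_lt ?ev0X.
  by case: k lt_ik => [|k] lt_ik; [lia | rewrite RopX_gt ?ev0X].
by rewrite RopX_eq rmorph0.
Qed.

(** * Forest polynomials tree by tree *)

Definition nleaves (t : bintree) : nat := size (leaves t).
Arguments nleaves : simpl never.

Lemma nleaves_Leaf : nleaves Leaf = 1%N.
Proof. by []. Qed.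

Lemma nleaves_Node l r : nleaves (Node l r) = (nleaves l + nleaves r)%N.
Proof. by rewrite /nleaves size_cat !size_map. Qed.

Lemma nleaves_gt0 t : (0 < nleaves t)%N.
Proof. by elim: t => // l IHl r _; rewrite nleaves_Node; lia. Qed.

Lemma nleaves_gt1 t : (1 < nleaves t)%N = (t != Leaf).
Proof.
case: t => // l r; rewrite nleaves_Node (_ : Node l r != Leaf); last exact/eqP.
by have := nleaves_gt0 l; have := nleaves_gt0 r; lia.
Qed.

Section TreePoly.
Variables (A : comNzRingType) (x : nat -> A).

(** The generating polynomial of the labellings of [t], a tree whose leftmost
    leaf is the leaf [p] of the forest, with root label at least [m] and with
    the label of a node [v] strictly below [b (rho v)].  For forest
    polynomials [b] is [succn]; applying R_i leads to other bounds.  The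
    parameter [m] carries the constraint imposed by the parent, which is what
    makes the sum over labellings a recursion on the tree. *)
Fixpoint tree_poly (b : nat -> nat) (p m : nat) (t : bintree) : A :=
  if t is Node l r then
    \sum_(m <= k < b p)
      x k * (tree_poly b p k l * tree_poly b (p + nleaves l) k.+1 r)
  else 1.

(** Only the bounds at the leaves of [t] matter, not their position; this
    allows a tree to slide by one place when a leaf to its left disappears. *)
Lemma eq_tree_poly b b' p p' m t :
    (forall q, (q < nleaves t)%N -> b (p + q)%N = b' (p' + q)%N) ->
  tree_poly b p m t = tree_poly b' p' m t.
Proof.
elim: t p p' m => //= l IHl r IHr p p' m; rewrite nleaves_Node => eq_b.
have l_gt0 := nleaves_gt0 l.
have -> : b p = b' p' by have := eq_b 0%N; rewrite !addn0; apply; lia.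
apply: eq_bigr => k _; congr (_ * (_ * _)).
  by apply: IHl => q lt_q; apply: eq_b; lia.
by apply: IHr => q lt_q; rewrite -!addnA; apply: eq_b; lia.
Qed.

Lemma tree_poly_eq0 b p m t :
  t != Leaf -> (b p <= m)%N -> tree_poly b p m t = 0.
Proof. by case: t => //= l r _ le_bm; rewrite big_geq. Qed.
End TreePoly.

(** When [i] is the last leaf of [l], the recursive call is false, as it
    should be: the leaves [i] and [i.+1] then lie in different subtrees. *)
Fixpoint cherry (t : bintree) (i : nat) : bool :=
  if t is Node l r then
    [&& l == Leaf, r == Leaf & i == 0%N]
    || (if (i < nleaves l)%N then cherry l i else cherry r (i - nleaves l))
  else false.

Fixpoint prune (t : bintree) (i : nat) : bintree :=
  match t with
  | Node Leaf Leaf | Leaf => Leaf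
  | Node l r => if (i < nleaves l)%N then Node (prune l i) r
                else Node l (prune r (i - nleaves l))
  end.

Fixpoint graft (t : bintree) (i : nat) : bintree :=
  if t is Node l r then
    if (i < nleaves l)%N then Node (graft l i) r
    else Node l (graft r (i - nleaves l))
  else Node Leaf Leaf.

Lemma prune_Node l r i : (l != Leaf) || (r != Leaf) ->
  prune (Node l r) i = if (i < nleaves l)%N then Node (prune l i) r
                       else Node l (prune r (i - nleaves l)).
Proof. by case: l; case: r. Qed.

Lemma cherry_Node l r i : (l != Leaf) || (r != Leaf) ->
  cherry (Node l r) i = if (i < nleaves l)%N then cherry l i
                        else cherry r (i - nleaves l).
Proof. by move=> /=; do 2!case: eqP. Qed.

Lemma cherry_lt t i : cherry t i -> (i.+1 < nleaves t)%N.
Proof.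
elim: t i => //= l IHl r IHr i; rewrite nleaves_Node.
case/orP => [/and3P[/eqP-> /eqP-> /eqP->] //|].
by case: ltnP => ? => [/IHl|/IHr]; lia.
Qed.

Lemma nleaves_prune t i : cherry t i -> nleaves t = (nleaves (prune t i)).+1.
Proof.
elim: t i => // l IHl r IHr i.
have [|] := boolP ((l != Leaf) || (r != Leaf)); last first.
  by rewrite negb_or !negbK => /andP[/eqP-> /eqP->].
move=> nleaf; rewrite cherry_Node // prune_Node // nleaves_Node.
case: ifP => _ /[dup] c; [move=> /IHl|move=> /IHr];
  by rewrite nleaves_Node => ->; lia.
Qed.

Lemma graft_prune t i : cherry t i -> graft (prune t i) i = t.
Proof.
elim: t i => // l IHl r IHr i.
have [|] := boolP ((l != Leaf) || (r != Leaf)); last first.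
  by rewrite negb_or !negbK => /andP[/eqP-> /eqP->].
move=> nleaf; rewrite cherry_Node // prune_Node //.
case: ltnP => [lt_i|le_i] c /=.
  have lt_Si := cherry_lt c; have lE := nleaves_prune c.
  by rewrite ifT ?IHl //; lia.
by rewrite ltnNge le_i /= IHr.
Qed.

Lemma cherry_succF t i : cherry t i -> cherry t i.+1 = false.
Proof.
elim: t i => // l IHl r IHr i.
have [|] := boolP ((l != Leaf) || (r != Leaf)); last first.
  by rewrite negb_or !negbK => /andP[/eqP-> /eqP->] /=; case: i.
move=> nleaf; rewrite !cherry_Node //.
case: ltnP => [_ c|le_i c]; first by rewrite cherry_lt // IHl.
by rewrite ltnNge leqW // subSn // IHr.
Qed.

Lemma exists_cherry t : t != Leaf -> exists i, cherry t i.
Proof.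
elim: t => // l IHl r IHr _.
have [/IHl[i c]|/negPn/eqP lE] := boolP (l != Leaf).
  exists i; have := cherry_lt c => lt_i; rewrite /= (ltnW lt_i) c orbT //.
have [/IHr[i c]|/negPn/eqP->] := boolP (r != Leaf); last first.
  by exists 0%N; rewrite lE.
by exists i.+1; rewrite lE /= subn1 c orbT.
Qed.

Section DividedDifference.
Variables (A : comNzRingType) (x : nat -> A).

(** The two bounds are those produced by R_{j+1} and R_j, and differ only at
    the leaf [j], where the label [j] is allowed by the first and not by the
    second.  So the difference counts the labellings in which the last node
    [v] on the left branch ending in the leaf [j] has the label [j].  If the
    right child of [v] is a node, its label has to exceed [j] while its
    leftmost leaf, [j.+1], bounds it by [j]: there is no such labelling.
    Otherwise [v] is a cherry, and removing it leaves exactly the labellings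
    of the pruned tree, the label [j] imposing nothing new on the parent of
    [v]. *)
Lemma tree_poly_diff t p m i : (m <= p + i)%N -> (i < nleaves t)%N ->
  let j := (p + i)%N in
  tree_poly x (fun q => q.+1 - (j < q))%N p m t
    - tree_poly x (fun q => q.+1 - (j <= q))%N p m t
  = if cherry t i then x j * tree_poly x succn p m (prune t i) else 0.
Proof.
elim: t p m i => [|l IHl r IHr] p m i; first by move=> _ _ j; rewrite subrr.
rewrite nleaves_Node => le_m lt_i j.
set b1 := fun q => _; set b0 := fun q => (_ - (_ <= _))%N.
have b1_gt q : (j < q)%N -> b1 q = q by rewrite /b1 => ->; rewrite subn1.
have b0_gt q : (j < q)%N -> b0 q = q by rewrite /b0 => /ltnW->; rewrite subn1.
have b1_le q : (q <= j)%N -> b1 q = q.+1 by rewrite /b1 ltnNge => ->.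
have b0_lt q : (q < j)%N -> b0 q = q.+1 by rewrite /b0 ltnNge => /negPf->.
have l_gt0 := nleaves_gt0 l.
have [lt_il|le_li] := ltnP i (nleaves l); last first.
  have -> : cherry (Node l r) i = cherry r (i - nleaves l).
    by rewrite /= ltnNge le_li gtn_eqF ?andbF //; lia.
  rewrite [tree_poly x b1 _ _ _]/= [tree_poly x b0 _ _ _]/=.
  rewrite b1_le ?b0_lt; try by rewrite /j; lia.
  rewrite -sumrB.
  under eq_big_nat => k /andP[_ lt_k].
    have lE b : (forall q, (q < j)%N -> b q = q.+1) ->
        tree_poly x b p k l = tree_poly x succn p k l.
      by move=> bE; apply: eq_tree_poly => q lt_q; apply: bE; rewrite /j; lia.
    rewrite (lE b0 b0_lt) (lE b1) => [|q /ltnW/b1_le //].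
    have := IHr (p + nleaves l)%N k.+1 (i - nleaves l)%N.
    have -> : (p + nleaves l + (i - nleaves l) = j)%N by rewrite /j; lia.
    move=> IH; rewrite -mulrBr -mulrBr {}IH; [|rewrite /j; lia|lia].
    over.
  case: ifP => c; last by rewrite big1 // => k _; rewrite !mulr0.
  rewrite prune_Node; last first.
    by rewrite -(nleaves_gt1 r) (leq_trans _ (cherry_lt c)) ?orbT.
  rewrite ltnNge le_li /=.
  rewrite big_distrr; apply: eq_bigr => k _ /=.
  by rewrite [RHS]mulrCA; congr (_ * _); apply: mulrCA.
(* The right subtree starts after the leaf [j], where both bounds agree. *)
have rE k :
    tree_poly x b1 (p + nleaves l) k r = tree_poly x b0 (p + nleaves l) k r.
  by apply: eq_tree_poly => q lt_q; rewrite b1_gt ?b0_gt // /j; lia.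
have [lE|lN] := eqVneq l Leaf.
  subst l; have i0 : i = 0%N by move: lt_il; rewrite nleaves_Leaf; lia.
  have jE : j = p by rewrite /j i0 addn0.
  have le_mp : (m <= p)%N by rewrite -jE.
  have b0E : b0 p = p by rewrite /b0 jE leqnn subn1.
  rewrite [tree_poly x b1 _ _ _]/= [tree_poly x b0 _ _ _]/= b0E b1_le ?jE //.
  rewrite big_nat_recr //= addrAC.
  rewrite (eq_bigr _ (fun k _ => congr1 (fun y => x k * (1 * y)) (rE k.+1))).
  rewrite subrr add0r mul1r nleaves_Leaf addn1 i0 andbT.
  have [->|rN] := eqVneq r Leaf; first by [].
  by rewrite tree_poly_eq0 ?b1_gt ?jE ?mulr0.
have nleaf : (l != Leaf) || (r != Leaf) by rewrite lN.
rewrite cherry_Node // prune_Node // lt_il.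
(* If [j] is the leftmost leaf, the second sum stops at k = p - 1, but its term
   for k = p would vanish because the root of [l] cannot be labelled then. *)
have -> : tree_poly x b0 p m (Node l r) = \sum_(m <= k < p.+1)
    x k * (tree_poly x b0 p k l * tree_poly x b0 (p + nleaves l) k.+1 r).
  have [i0|i_gt0] := posnP i; last by rewrite /= b0_lt //; rewrite /j; lia.
  have jE : j = p by rewrite /j i0 addn0.
  have b0E : b0 p = p by rewrite /b0 jE leqnn subn1.
  rewrite /= b0E [RHS]big_nat_recr /=; last by rewrite -jE.
  by rewrite tree_poly_eq0 ?b0E // mul0r mulr0 addr0.
rewrite [tree_poly x b1 _ _ _]/= b1_le ?leq_addr // -sumrB.
under eq_big_nat => k /andP[_ lt_k].
  rewrite -rE -mulrBr -mulrBl IHl; [|lia..].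
  over.
case: ifP => c; last by rewrite big1 // => k _; rewrite mul0r mulr0.
rewrite big_distrr; apply: eq_bigr => k _ /=.
have -> : tree_poly x b1 (p + nleaves l) k.+1 r
    = tree_poly x succn (p + nleaves (prune l i)) k.+1 r.
  apply: eq_tree_poly => q lt_q; rewrite b1_gt; last by rewrite /j; lia.
  by rewrite (nleaves_prune c); lia.
by rewrite -mulrA mulrCA.
Qed.
End DividedDifference.

(** The number of labels below [c] that differ from [i]: the bound into which
    R_i turns the bound [c]. *)
Definition squash i c := (c - (i < c))%N.

(** The effect of R_i on a sum over the label of a node: the term of the label
    [i] dies and the larger labels drop by one. *)
Lemma sum_squash (V : zmodType) i (f g : nat -> V) m c :
    (forall k, (k < i)%N -> f k = g k) -> f i = 0 ->
    (forall k, (i <= k)%N -> f k.+1 = g k) ->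
  \sum_(m <= k < c) f k = \sum_(squash i m <= k < squash i c) g k.
Proof.
move=> f_lt f_eq f_gt; elim: c => [|c IHc].
  by rewrite !big_geq // /squash; lia.
have [le_mc|lt_cm] := leqP m c; last by rewrite !big_geq // /squash; lia.
rewrite big_nat_recr //= IHc.
have [lt_ci|lt_ic|ci] := ltngtP c i.
- have [-> ->] : squash i c.+1 = c.+1 /\ squash i c = c by rewrite /squash; lia.
  by rewrite big_nat_recr ?f_lt //= /squash; lia.
- case: c lt_ic le_mc {IHc} => // c lt_ic le_mc.
  have [-> ->] : squash i c.+2 = c.+1 /\ squash i c.+1 = c.
    by rewrite /squash; lia.
  by rewrite big_nat_recr ?f_gt //= /squash; lia.
have -> : squash i c.+1 = squash i c by rewrite /squash; lia.
by rewrite ci f_eq addr0.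
Qed.

(** * Compatible labellings, tree by tree *)

Lemma inodes_Node l r a : (a \in inodes (Node l r))
  = if a is b :: q then q \in inodes (if b then r else l) else true.
Proof.
case: a => [|b q] //=; rewrite inE /= mem_cat.
have inj_cons (c : bool) : injective (cons c) by move=> u v [].
have other (c d : bool) (s : seq address) :
    (c :: q \in map (cons d) s) = (c == d) && (q \in s).
  case: eqP => [->|ne_cd]; first by rewrite mem_map.
  by apply/mapP => -[u _ []].
by rewrite !other; case: b; rewrite ?orbF.
Qed.

Lemma inodes_nil t : ([::] \in inodes t) = (t != Leaf).
Proof. by case: t => // l r; rewrite inodes_Node; apply/esym/eqP. Qed.

Lemma uniq_inodes t : uniq (inodes t).
Proof.
have inj_cons (c : bool) : injective (cons c) by move=> u v [].
elim: t => //= l Ul r Ur; rewrite cat_uniq !map_inj_uniq // Ul Ur andbT /=.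
apply/andP; split; first by rewrite mem_cat; apply/norP; split; apply/mapP => -[].
by apply/hasPn => _ /mapP[u _ ->]; apply/mapP => -[].
Qed.

Lemma left_leaf_in t a : left_leaf t a \in leaves t.
Proof.
by elim: t a => //= l IHl r IHr [|[] q]; rewrite mem_cat map_f ?orbT.
Qed.

Definition left_rank t a := index (left_leaf t a) (leaves t).

Lemma left_rank_false l r q :
  left_rank (Node l r) (false :: q) = left_rank l q.
Proof.
rewrite /left_rank /= index_cat map_f ?left_leaf_in // index_map //.
by move=> u v [].
Qed.

Lemma left_rank_true l r q :
  left_rank (Node l r) (true :: q) = (nleaves l + left_rank r q)%N.
Proof.
rewrite /left_rank /= index_cat ifF; last by apply/negP => /mapP[].
by rewrite size_map index_map // => u v [].
Qed.

Lemma left_rank_nil t : left_rank t [::] = 0%N.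
Proof.
elim: t => //= l IHl r _; rewrite -[RHS]IHl -(left_rank_false l r).
by [].
Qed.

(** The recursive form of compatibility, parallel to [tree_poly] with the
    bounds of a forest polynomial.  Here [p] is the rank of the leftmost leaf,
    hence the value of rho at the root. *)
Fixpoint admissible (p m : nat) (t : bintree) (f : address -> nat) : bool :=
  if t is Node l r then
    [&& (m <= f [::] <= p)%N,
        admissible p (f [::]) l (fun q => f (false :: q)) &
        admissible (p + nleaves l) (f [::]).+1 r (fun q => f (true :: q))]
  else true.

Lemma eq_admissible p m t f g :
  {in inodes t, f =1 g} -> admissible p m t f = admissible p m t g.
Proof.
elim: t p m f g => //= l IHl r IHr p m f g eq_fg.
rewrite eq_fg ?inE //; congr [&& _, _ & _].
  by apply: IHl => q q_l; apply: eq_fg; rewrite inodes_Node.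
by apply: IHr => q q_r; apply: eq_fg; rewrite inodes_Node.
Qed.

Lemma admissibleP p m t f :
  reflect
    ((t != Leaf -> (m <= f [::])%N) /\
     forall a, a \in inodes t ->
       [/\ (f a <= p + left_rank t a)%N,
           rcons a false \in inodes t -> (f a <= f (rcons a false))%N &
           rcons a true \in inodes t -> (f a < f (rcons a true))%N])
    (admissible p m t f).
Proof.
elim: t p m f => [|l IHl r IHr] p m f; first by apply: ReflectT.
apply: (iffP and3P) => [[/andP[le_m le_p] /IHl[l0 ok_l] /IHr[r0 ok_r]]|].
  split=> // -[_|[] q].
  - rewrite left_rank_nil addn0; split=> //=.
      by rewrite inodes_Node inodes_nil.
    by rewrite inodes_Node inodes_nil.
  - rewrite inodes_Node /= => /ok_r[b1 b2 b3].
    by rewrite !inodes_Node left_rank_true addnA.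
  - rewrite inodes_Node /= => /ok_l[b1 b2 b3].
    by rewrite !inodes_Node left_rank_false.
case=> m0 ok; have nN : Node l r != Leaf by apply/eqP.
have [|b1 b2 b3] := ok [::]; first by rewrite inodes_Node.
rewrite left_rank_nil addn0 in b1; split; first by rewrite m0.
  apply/IHl; split=> [lN|a a_l].
    by apply: b2; rewrite (inodes_Node l r [:: false]) inodes_nil.
  have [|c1 c2 c3] := ok (false :: a); first by rewrite inodes_Node.
  by rewrite !inodes_Node /= left_rank_false in c1 c2 c3 *.
apply/IHr; split=> [rN|a a_r].
  by apply: b3; rewrite (inodes_Node l r [:: true]) inodes_nil.
have [|c1 c2 c3] := ok (true :: a); first by rewrite inodes_Node.
by rewrite !inodes_Node /= left_rank_true addnA in c1 c2 c3 *.
Qed.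

(** The value lists, in prefix order, of the admissible labellings of [t]. *)
Fixpoint labellings (p m : nat) (t : bintree) : seq (seq nat) :=
  if t is Node l r then
    [seq k :: y | k <- index_iota m p.+1,
       y <- [seq y1 ++ y2 | y1 <- labellings p k l,
                            y2 <- labellings (p + nleaves l) k.+1 r]]
  else [:: [::]].

Lemma labellingsP p m t y :
  reflect (exists2 f, y = map f (inodes t) & admissible p m t f)
          (y \in labellings p m t).
Proof.
elim: t p m y => [|l IHl r IHr] p m y /=.
  by rewrite inE; apply: (iffP eqP) => [->|[f ->]] //; exists (fun _ => 0%N).
apply: (iffP allpairsPdep) => [[k [z [k_m /allpairsP[[y1 y2] /= []]]]]|].
  move=> /IHl[f -> ok_f] /IHr[g -> ok_g] -> ->.
  exists (fun a => match a with [::] => k | b :: q => if b then g q else f q end).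
    by rewrite /= map_cat -!map_comp.
  by rewrite ok_f ok_g !andbT; rewrite mem_index_iota in k_m.
case=> f -> /and3P[le_f ok_l ok_r]; exists (f [::]).
eexists; split; first by rewrite mem_index_iota.
  apply/allpairsP; eexists (_, _); split=> /=; last reflexivity.
    by apply/IHl; exists (fun q => f (false :: q)).
  by apply/IHr; exists (fun q => f (true :: q)).
by rewrite map_cat -!map_comp.
Qed.

Lemma size_labellings p m t y :
  y \in labellings p m t -> size y = size (inodes t).
Proof. by case/labellingsP => f ->; rewrite size_map. Qed.

Lemma allpairs_cat_uniq (s t : seq (seq nat)) n :
    {in s, forall y, size y = n} -> uniq s -> uniq t ->
  uniq [seq y1 ++ y2 | y1 <- s, y2 <- t].
Proof.
move=> size_s Us Ut; apply: allpairs_uniq => // -[y1 y2] [z1 z2].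
case/allpairsP => -[a1 a2] /= [y1s _ [-> ->]] {y1 y2}.
case/allpairsP => -[b1 b2] /= [z1s _ [-> ->]] {z1 z2} eq_yz.
have sz : size a1 = size b1 by rewrite !size_s.
have := congr1 (take (size a1)) eq_yz; have := congr1 (drop (size a1)) eq_yz.
by rewrite !drop_size_cat // !take_size_cat // => -> ->.
Qed.

Lemma uniq_labellings p m t : uniq (labellings p m t).
Proof.
elim: t p m => //= l IHl r IHr p m; apply: allpairs_uniq_dep.
- exact: iota_uniq.
- move=> k _; apply: (@allpairs_cat_uniq _ _ (size (inodes l))) => //.
  by move=> y /size_labellings.
- by move=> [k1 y1] [k2 y2] _ _ /= [-> ->].
Qed.

Section Bridge.
Variables (A : comNzRingType) (x : nat -> A).

Lemma sum_labellings p m t :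
  \sum_(y <- labellings p m t) \prod_(k <- y) x k = tree_poly x succn p m t.
Proof.
elim: t p m => [|l IHl r IHr] p m /=; first by rewrite big_seq1 big_nil.
rewrite big_allpairs_dep; apply: eq_bigr => k _ /=.
under eq_bigr do rewrite big_cons.
rewrite -big_distrr big_allpairs_dep /= -IHl -IHr big_distrl; congr (_ * _).
apply: eq_bigr => y1 _; rewrite big_distrr; apply: eq_bigr => y2 _.
by rewrite big_cat.
Qed.
End Bridge.

(** * Forest polynomials as products of tree polynomials *)

Definition offset (F : forest) n := (\sum_(m < n) nleaves (F m))%N.

Lemma offset0 F : offset F 0 = 0%N.
Proof. exact: big_ord0. Qed.

Lemma offsetS F n : offset F n.+1 = (offset F n + nleaves (F n))%N.
Proof. exact: big_ord_recr. Qed.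

Lemma rhoE F n a : rho F (n, a) = (offset F n + left_rank (F n) a)%N.
Proof. by []. Qed.

(** Products over all trees are cut off at a bound [N] that a forest can share
    with its prunings. *)
Definition supported (F : forest) N := forall n, (N <= n)%N -> F n = Leaf.

Lemma exists_supported F M : exists2 N, (M <= N)%N & supported F N.
Proof.
exists (maxn M (\max_(n <- finsupp F) n).+1); first exact: leq_maxl.
move=> n; rewrite geq_max => /andP[_ lt_n]; apply/eqP; apply/negPn/negP => nN.
suff: (n <= \max_(n <- finsupp F) n)%N by rewrite leqNgt lt_n.
by apply: leq_bigmax_seq; rewrite ?mem_finsupp.
Qed.

Fixpoint nodes (F : forest) N : seq node :=
  if N is N'.+1 then nodes F N' ++ [seq (N', a) | a <- inodes (F N')] else [::].

Lemma mem_nodes F N v : (v \in nodes F N) = (v.1 < N)%N && (v \in IN F).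
Proof.
elim: N => [|N IHN] //=; rewrite mem_cat {}IHN in_IN ltnS [in RHS]leq_eqVlt.
case: v => n a /=; have [->|ne_nN] := eqVneq n N.
  by rewrite ltnn /= mem_map // => u v [].
have /negPf-> : (n, a) \notin [seq (N, a') | a' <- inodes (F N)].
  by apply/mapP => -[u _ [e _]]; rewrite e eqxx in ne_nN.
by rewrite orbF.
Qed.

Lemma uniq_nodes F N : uniq (nodes F N).
Proof.
elim: N => //= N UN; rewrite cat_uniq UN map_inj_uniq ?uniq_inodes ?andbT /=.
  by apply/hasPn => _ /mapP[u _ ->]; rewrite mem_nodes ltnn.
by move=> u v [].
Qed.

Lemma nodes_IN F N : supported F N -> perm_eq (nodes F N) (IN F).
Proof.
move=> FN; apply: uniq_perm; rewrite ?uniq_nodes ?fset_uniq // => v.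
rewrite mem_nodes; case: ltnP => //= /FN vN.
by rewrite in_IN vN.
Qed.

Lemma compatibleP F (kappa : IN F -> nat) (f : node -> nat) :
    (forall v, kappa v = f (val v)) ->
  reflect (forall n, admissible (offset F n) 0 (F n) (fun a => f (n, a)))
          (compatible kappa).
Proof.
move=> kE; apply: (iffP forallP) => [ok n|ok v].
  apply/admissibleP; split=> // a a_n.
  have a_F : (n, a) \in IN F by rewrite in_IN.
  have /and3P[b1 /forallP b2 /forallP b3] := ok [` a_F]%fset.
  rewrite kE in b1; split=> // c_n.
    have c_F : (n, rcons a false) \in IN F by rewrite in_IN.
    by have /implyP/(_ (eqxx _)) := b2 [` c_F]%fset; rewrite !kE.
  have c_F : (n, rcons a true) \in IN F by rewrite in_IN.
  by have /implyP/(_ (eqxx _)) := b3 [` c_F]%fset; rewrite !kE.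
have := fsvalP v; rewrite in_IN => v_F.
have /admissibleP[_ /(_ _ v_F)[b1 b2 b3]] := ok (val v).1.
apply/and3P; rewrite kE; split.
- by rewrite [val v]surjective_pairing.
- apply/forallP => w; apply/implyP => /eqP wE; rewrite kE wE.
  rewrite {1}[val v]surjective_pairing; apply: b2.
  by have := fsvalP w; rewrite wE in_IN.
- apply/forallP => w; apply/implyP => /eqP wE; rewrite kE wE.
  rewrite {1}[val v]surjective_pairing; apply: b3.
  by have := fsvalP w; rewrite wE in_IN.
Qed.

Fixpoint forest_labellings (F : forest) N : seq (seq nat) :=
  if N is N'.+1 then
    [seq y1 ++ y2 | y1 <- forest_labellings F N',
                    y2 <- labellings (offset F N') 0 (F N')]
  else [:: [::]].

Lemma forest_labellingsP F N y :
  reflect (exists2 f : node -> nat, y = map f (nodes F N) &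
             forall n, (n < N)%N ->
               admissible (offset F n) 0 (F n) (fun a => f (n, a)))
          (y \in forest_labellings F N).
Proof.
elim: N y => [|N IHN] y.
  rewrite inE; apply: (iffP eqP) => [->|[f ->]] //.
  by exists (fun _ => 0%N).
apply: (iffP allpairsP) => [[[y1 y2] /= []]|].
  move=> /IHN[f -> ok_f] /labellingsP[g -> ok_g] ->.
  exists (fun v => if v.1 == N then g v.2 else f v).
    rewrite map_cat -map_comp; congr (_ ++ _).
      by apply/eq_in_map => v; rewrite mem_nodes => /andP[/ltn_eqF->].
    by apply: eq_map => a /=; rewrite eqxx.
  move=> n; rewrite ltnS leq_eqVlt => /orP[/eqP->|lt_n] /=; first by rewrite eqxx.
  by rewrite ltn_eqF // ok_f.
case=> f -> ok; eexists (_, _); split=> /=; last by rewrite map_cat.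
  by apply/IHN; exists f => // n lt_n; apply: ok; apply: ltnW.
by apply/labellingsP; exists (fun a => f (N, a)); rewrite -?map_comp ?ok.
Qed.

Lemma uniq_forest_labellings F N : uniq (forest_labellings F N).
Proof.
elim: N => //= N UN.
apply: (@allpairs_cat_uniq _ _ (size (nodes F N))) => //.
  by move=> y /forest_labellingsP[f -> _]; rewrite size_map.
exact: uniq_labellings.
Qed.

Definition forest_prod (A : comNzRingType) (x : nat -> A) b F N : A :=
  \prod_(n < N) tree_poly x b (offset F n) 0 (F n).

Lemma sum_forest_labellings (A : comNzRingType) (x : nat -> A) F N :
  \sum_(y <- forest_labellings F N) \prod_(k <- y) x k
  = forest_prod x succn F N.
Proof.
elim: N => [|N IHN]; first by rewrite /forest_prod big_ord0 big_seq1 big_nil.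
rewrite /forest_prod big_ord_recr /= -/(forest_prod x succn F N) -IHN.
rewrite big_allpairs_dep big_distrl /=; apply: eq_bigr => y1 _.
rewrite -sum_labellings big_distrr /=; apply: eq_bigr => y2 _.
by rewrite big_cat.
Qed.

(** The value of the forest polynomial at [x]; for [x := X] it is the forest
    polynomial itself. *)
Definition forest_poly_at (A : comNzRingType) (x : nat -> A) (F : forest) : A :=
  \sum_(kappa : {ffun IN F -> 'I_(rho_bound F)} |
          compatible (fun v => kappa v : nat))
    \prod_(v : IN F) x (kappa v).

(** The sum over compatible labellings is turned into a sum over value lists,
    because these can be concatenated: listing the values along [nodes F N] is
    a bijection between the compatible labellings and [forest_labellings F N].
    *)
Lemma forest_poly_atE (A : comNzRingType) (x : nat -> A) F N :
  supported F N -> forest_poly_at x F = forest_prod x succn F N.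
Proof.
move=> FN; rewrite -sum_forest_labellings /forest_poly_at.
pose K := {ffun IN F -> 'I_(rho_bound F)}.
pose ext (kappa : K) (v : node) : nat :=
  oapp (fun w => kappa w : nat) 0%N (insub v).
have extE (kappa : K) v : kappa v = ext kappa (val v) :> nat.
  by rewrite /ext valK.
pose vals kappa := map (ext kappa) (nodes F N).
pose C := [pred kappa : K | compatible (fun v => kappa v : nat)].
transitivity (\sum_(y <- map vals (enum C)) \prod_(k <- y) x k).
  rewrite big_map big_enum_cond /=; apply: eq_big => [kappa|kappa _].
    by rewrite andbT.
  rewrite big_map (perm_big _ (nodes_IN FN)) big_seq_fsetE /=.
  by apply: eq_bigr => v _; rewrite extE.
apply: perm_big; apply: uniq_perm; last 1 first.
- move=> y; apply/mapP/forest_labellingsP => [[kappa]|[f -> ok]].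
    rewrite mem_enum => /compatibleP ok ->; exists (ext kappa) => // n _.
    by apply: ok => v; apply: extE.
  have okf : compatible (fun v : IN F => f (val v)).
    apply/compatibleP => [//|n]; have [/ok //|le_Nn] := ltnP n N.
    by rewrite FN.
  pose kappa : K := [ffun v => Ordinal (compatible_lt okf v)].
  have kE v : kappa v = f (val v) :> nat by rewrite ffunE.
  exists kappa; first rewrite mem_enum.
    by apply/(compatibleP kE) => n; have [/ok //|le_Nn] := ltnP n N; rewrite FN.
  apply/eq_in_map => v; rewrite (perm_mem (nodes_IN FN)) => v_F.
  by rewrite -[v]/(val [` v_F]%fset) -extE kE.
- rewrite map_inj_in_uniq ?enum_uniq // => k1 k2 _ _ eq_k; apply/ffunP => v.
  apply: val_inj => /=; rewrite !extE; have := fsvalP v.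
  rewrite -(perm_mem (nodes_IN FN)) => v_F.
  by move: eq_k => /eq_in_map; apply.
- exact: uniq_forest_labellings.
Qed.

(** * Pruning a cherry of a forest *)

Lemma offset_le F m n : (m <= n)%N -> (offset F m <= offset F n)%N.
Proof.
move=> le_mn; rewrite -(subnKC le_mn); elim: (n - m)%N => [|k IHk].
  by rewrite addn0.
by rewrite addnS offsetS; lia.
Qed.

Definition leaf_in (F : forest) j n :=
  (offset F n <= j < offset F n + nleaves (F n))%N.

Lemma leaf_in_inj F j n n' : leaf_in F j n -> leaf_in F j n' -> n = n'.
Proof.
wlog lt_nn' : n n' / (n < n')%N.
  by move=> W jn jn'; have [] := ltngtP n n' => // lt; [apply: W|apply/esym/W].
rewrite /leaf_in -!offsetS => /andP[_ lt_j] /andP[le_j _].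
by have := offset_le F lt_nn'; lia.
Qed.

Lemma exists_leaf_in F j : exists n, leaf_in F j n.
Proof.
have le_off k : (k <= offset F k)%N.
  by elim: k => // k; rewrite offsetS; have := nleaves_gt0 (F k); lia.
have [N] : exists N, (j < offset F N)%N by exists j.+1.
elim: N => [|n IHn]; first by rewrite offset0.
have [/IHn //|le_j lt_j] := ltnP j (offset F n).
by exists n; rewrite /leaf_in le_j -offsetS.
Qed.

Definition prunes_at n (F : forest) j (H : forest) :=
  [/\ (offset F n <= j)%N, cherry (F n) (j - offset F n),
      H n = prune (F n) (j - offset F n) &
      forall k, k != n -> H k = F k].

Definition prunes F j H := exists n, prunes_at n F j H.

Section PrunesAt.
Variables (n j : nat) (F H : forest).
Hypothesis FH : prunes_at n F j H.

Lemma offset_prunes_le k : (k <= n)%N -> offset H k = offset F k.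
Proof.
case: FH => _ _ _ HF le_kn; apply: eq_bigr => i _; rewrite HF //.
by have := ltn_ord i; lia.
Qed.

Lemma offset_prunes_gt k : (n < k)%N -> offset F k = (offset H k).+1.
Proof.
move=> lt_nk; rewrite -(subnKC lt_nk); elim: (k - n.+1)%N => [|d IHd].
  rewrite addn0 !offsetS offset_prunes_le //.
  by case: FH => _ /nleaves_prune-> -> _; rewrite addnS.
rewrite addnS (offsetS F) (offsetS H) IHd.
by case: FH => _ _ _ ->; rewrite ?addSn //; lia.
Qed.

Lemma leaf_in_prunesl : leaf_in F j n /\ leaf_in F j.+1 n.
Proof. by case: FH => le_j /cherry_lt lt_j _ _; rewrite /leaf_in; lia. Qed.

Lemma leaf_in_prunesr : leaf_in H j n.
Proof.
case: FH => le_j c HE _; rewrite /leaf_in offset_prunes_le // HE.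
by have := cherry_lt c; rewrite (nleaves_prune c); lia.
Qed.
End PrunesAt.

(** [F] is recovered from [H] by grafting a cherry on the leaf [j]. *)
Lemma prunes_inj F F' j H : prunes F j H -> prunes F' j H -> F = F'.
Proof.
move=> [n FH] [n' F'H].
have nn' := leaf_in_inj (leaf_in_prunesr FH) (leaf_in_prunesr F'H).
subst n'; have := offset_prunes_le FH (leqnn n).
rewrite (offset_prunes_le F'H) // => eq_off.
case: FH F'H => _ c HE HF [_ c' HE' HF']; apply/fsfunP => k.
have [->|ne_kn] := eqVneq k n; last by rewrite -HF // HF'.
by rewrite -(graft_prune c) -(graft_prune c') -HE -HE' eq_off.
Qed.

Lemma prunes_fun F j H H' : prunes F j H -> prunes F j H' -> H = H'.
Proof.
move=> [n FH] [n' FH'].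
have nn' := leaf_in_inj (leaf_in_prunesl FH).1 (leaf_in_prunesl FH').1.
subst n'; case: FH FH' => _ _ HE HF [_ _ HE' HF']; apply/fsfunP => k.
by have [->|ne_kn] := eqVneq k n; [rewrite HE HE'|rewrite HF ?HF'].
Qed.

(** The leaf [j.+1] cannot be a right child and a left child at once. *)
Lemma prunes_succ F j H H' : prunes F j H -> ~ prunes F j.+1 H'.
Proof.
move=> [n FH] [n' FH'].
have nn' := leaf_in_inj (leaf_in_prunesl FH).2 (leaf_in_prunesl FH').1.
subst n'; case: FH FH' => le_j c _ _ [_ c' _ _].
by move: c'; rewrite subSn // cherry_succF.
Qed.

Lemma exists_prunes (F : forest) n i : cherry (F n) i ->
  exists H, prunes_at n F (offset F n + i) H.
Proof.
move=> c; exists [fsfun F with n |-> prune (F n) i].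
split; rewrite ?leq_addr ?addKn ?fsfun_with // => k ne_kn.
by rewrite fsfun_withE (negPf ne_kn).
Qed.

Definition empty_forest : forest := [fsfun].

Lemma nonempty_forest F : F != empty_forest -> exists n, F n != Leaf.
Proof.
move=> nF; have [F0|[n n_F]] := fset_0Vmem (finsupp F); last first.
  by exists n; rewrite -mem_finsupp.
by case/eqP: nF; apply/fsfunP => n; rewrite fsfunE fsfun_dflt // F0.
Qed.

(** Every nonempty forest has a cherry, and pruning it lowers the number of
    leaves in the trees below any bound for the support. *)
Lemma prunes_ind (P : forest -> Prop) :
    P empty_forest -> (forall F j H, prunes F j H -> P H -> P F) ->
  forall F, P F.
Proof.
move=> P0 PS F; have [N _ FN] := exists_supported F 0.
have [d] := ubnP (offset F N).
elim: d F FN => // d IHd F FN; rewrite ltnS => le_d.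
have [->|nF] := eqVneq F empty_forest; first exact: P0.
have [n nL] := nonempty_forest nF.
have [i /exists_prunes[H FH]] := exists_cherry nL.
have lt_nN : (n < N)%N by rewrite ltnNge; apply/negP => /FN nE; rewrite nE in nL.
apply: (PS _ _ H); first by exists n; apply: FH.
apply: IHd; last by have := offset_prunes_gt FH lt_nN; lia.
by move=> k le_Nk; case: FH => _ _ _ ->; [apply: FN|lia].
Qed.

(** * Trimming forest polynomials *)

Lemma malg_ind (K : choiceType) (Q : {malg int[K]} -> Prop) :
    Q 0 -> (forall a b, Q a -> Q b -> Q (a + b)) ->
    (forall c k, Q << c *g k >>) ->
  forall a, Q a.
Proof. by move=> Q0 QD QU a; rewrite [a]monalgE; elim/big_ind: _. Qed.

Section ShiftOperators.
(* The trimming calculus involves only the action of the R_i on the variables,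
   the cosimplicial identities, the cancellability of the variables and the
   constant term [ev]. *)
Variables (A : comNzRingType) (x : nat -> A) (R : nat -> {rmorphism A -> A}).
Hypothesis R_lt : forall i j, (j < i)%N -> R i (x j) = x j.
Hypothesis R_eq : forall i, R i (x i) = 0.
Hypothesis R_gt : forall i j, (i <= j)%N -> R i (x j.+1) = x j.
Hypothesis R_comp : forall i j f, (j <= i)%N -> R i (R j f) = R j (R i.+1 f).
Hypothesis x_reg : forall j f, x j * f = 0 -> f = 0.
Variable ev : {rmorphism A -> int}.
Hypothesis ev_x : forall j, ev (x j) = 0.
Hypothesis ev_R : forall i f, ev (R i f) = ev f.

(** A division-free form of the trimming operator T_j: it computes x_j T_j. *)
Definition Dop j f := R j.+1 f - R j f.

Lemma Dop_R_ge i j f : (i <= j)%N -> Dop j (R i f) = R i (Dop j.+1 f).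
Proof.
by move=> le_ij; rewrite /Dop rmorphB (R_comp _ le_ij) (R_comp _ (leqW le_ij)).
Qed.

Lemma Dop_R_lt i j f : (j < i)%N -> Dop j (R i.+1 f) = R i (Dop j f).
Proof.
move=> lt_ji; rewrite /Dop rmorphB.
by rewrite -(R_comp _ lt_ji) -(R_comp _ (ltnW lt_ji)).
Qed.

Lemma Dop_R_eq j f : Dop j (R j.+1 f) = R j.+1 (Dop j f) + R j (Dop j.+1 f).
Proof.
rewrite /Dop !rmorphB addrA (R_comp _ (leqnSn j)) subrK.
by rewrite (R_comp _ (leqnn j.+1)).
Qed.

Lemma R_tree_poly i b p m t :
  R i (tree_poly x b p m t)
  = tree_poly x (fun q => squash i (b q)) p (squash i m) t.
Proof.
elim: t p m => [|l IHl r IHr] p m; first exact: rmorph1.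
rewrite /= rmorph_sum /=; apply: (@sum_squash _ i).
- move=> k lt_ki; rewrite !rmorphM /= R_lt // IHl IHr.
  by congr (_ * (tree_poly _ _ _ _ _ * tree_poly _ _ _ _ _)); rewrite /squash; lia.
- by rewrite rmorphM /= R_eq mul0r.
- move=> k le_ik; rewrite !rmorphM /= R_gt // IHl IHr.
  by congr (_ * (tree_poly _ _ _ _ _ * tree_poly _ _ _ _ _)); rewrite /squash; lia.
Qed.

Local Notation P := (forest_poly_at x).
Local Notation D := Dop.

Lemma R_forest_prod i b F N :
  R i (forest_prod x b F N) = forest_prod x (fun q => squash i (b q)) F N.
Proof.
rewrite rmorph_prod; apply: eq_bigr => n _.
by rewrite R_tree_poly.
Qed.

(** In the factorization of P_F into tree polynomials, only the tree that
    contains the leaf [j] has different bounds after R_{j+1} and after R_j, so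
    [tree_poly_diff] decides; the trees to its right slide by one place. *)
Lemma Dop_forest_poly_at F j :
  (exists2 H, prunes F j H & D j (P F) = x j * P H) \/
  (forall H, ~ prunes F j H) /\ D j (P F) = 0.
Proof.
have [n jn] := exists_leaf_in F j; have /andP[le_j lt_j] := jn.
have [N lt_nN FN] := exists_supported F n.+1.
pose b1 q := (q.+1 - (j < q))%N; pose b0 q := (q.+1 - (j <= q))%N.
have tE k : k != n ->
    tree_poly x b1 (offset F k) 0 (F k) = tree_poly x b0 (offset F k) 0 (F k).
  move=> ne_kn; apply: eq_tree_poly => q lt_q.
  suff : (offset F k + q != j)%N by rewrite /b1 /b0; lia.
  apply: contra_neq ne_kn => jE; apply: leaf_in_inj jn.
  by rewrite /leaf_in; lia.
have DE : D j (P F) = (\prod_(k < N | k != n :> nat)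
      tree_poly x b1 (offset F k) 0 (F k)) *
    (if cherry (F n) (j - offset F n) then
       x j * tree_poly x succn (offset F n) 0 (prune (F n) (j - offset F n))
     else 0).
  rewrite /Dop (forest_poly_atE x FN) !R_forest_prod /forest_prod.
  rewrite (bigD1 (Ordinal lt_nN)) //= [X in _ - X](bigD1 (Ordinal lt_nN)) //=.
  have := @tree_poly_diff _ x (F n) (offset F n) 0 (j - offset F n).
  rewrite subnKC //= => <- //; last by lia.
  rewrite -[X in _ - X * _]/(tree_poly x b0 _ _ _) -/b1 -/b0.
  rewrite mulrBr mulrC [in X in _ - X]mulrC; congr (_ * _ - _ * _).
  by apply: eq_bigr => k ne_kn; rewrite -tE.
have [c|nc] := boolP (cherry (F n) (j - offset F n)); last first.
  right; rewrite DE (negPf nc) mulr0; split=> // H [n' FH].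
  have nn' := leaf_in_inj jn (leaf_in_prunesl FH).1; subst n'.
  by case: FH => _ c; rewrite c in nc.
have [H FH] := exists_prunes c; rewrite subnKC // in FH.
left; exists H; first by exists n.
have HN : supported H N.
  by move=> k le_Nk; case: FH => _ _ _ ->; [apply: FN|lia].
rewrite DE c (forest_poly_atE x HN) /forest_prod.
rewrite [in RHS](bigD1 (Ordinal lt_nN)) //=.
rewrite (offset_prunes_le FH) //; case: (FH) => _ _ -> HF.
rewrite mulrCA; congr (_ * _); rewrite mulrC; congr (_ * _).
apply: eq_bigr => k ne_kn; rewrite HF //; apply: eq_tree_poly => q lt_q.
have [lt_kn|lt_nk|kn] := ltngtP (k : nat) n.
- rewrite (offset_prunes_le FH (ltnW lt_kn)) /b1.
  by have := offset_le F lt_kn; rewrite offsetS; lia.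
- have offE := offset_prunes_gt FH lt_nk.
  have [/andP[_ lt1] /andP[_ lt2]] := leaf_in_prunesl FH.
  have := offset_le F lt_nk; rewrite offsetS /b1; lia.
- by rewrite kn eqxx in ne_kn.
Qed.

Lemma ev_forest_poly_at F : ev (P F) = (F == empty_forest)%:R.
Proof.
have [N _ FN] := exists_supported F 0.
have ev_tree b p m t : ev (tree_poly x b p m t) = (t == Leaf)%:R.
  case: t => [|l r]; first by rewrite rmorph1.
  by rewrite /= rmorph_sum big1 // => k _; rewrite rmorphM ev_x mul0r.
rewrite (forest_poly_atE x FN) rmorph_prod; have [->|nF] := eqVneq F empty_forest.
  by rewrite big1 // => n _; rewrite fsfunE rmorph1.
have [n nL] := nonempty_forest nF.
have lt_nN : (n < N)%N by rewrite ltnNge; apply/negP => /FN nE; rewrite nE in nL.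
by rewrite (bigD1 (Ordinal lt_nN)) //= ev_tree (negPf nL) mul0r.
Qed.

Local Notation E := (mmap (intmul (1 : A)) P).

Lemma ev_E a : ev (E a) = a@_empty_forest.
Proof.
elim/malg_ind: a => [|a b IHa IHb|c G]; first by rewrite !raddf0.
  by rewrite !raddfD /= IHa IHb.
rewrite mmapU rmorphM rmorph_int ev_forest_poly_at mcoeffU intz.
by case: eqP; rewrite ?mulr1 ?mulr0.
Qed.

(** Trimming an expansion: since a forest is determined by [j] and its pruning
    at [j], the terms that survive do not collide, and they keep their
    coefficients. *)
Lemma Dop_E j a : exists2 a' : {malg int[forest]},
  D j (E a) = x j * E a' & forall F H, prunes F j H -> a'@_H = a@_F.
Proof.
elim/malg_ind: a => [|a b [a' aE a'P] [b' bE b'P]|c G].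
- exists 0; last by move=> F H _; rewrite !mcoeff0.
  by rewrite raddf0 /Dop !rmorph0 subrr mulr0.
- exists (a' + b'); last by move=> F H FH; rewrite !mcoeffD (a'P F) ?(b'P F).
  by rewrite raddfD [in RHS]raddfD mulrDr -aE -bE /Dop !rmorphD opprD addrACA.
- have DU : D j (E << c *g G >>) = c%:~R * D j (P G).
    by rewrite mmapU /Dop !rmorphM !rmorph_int -mulrBr.
  have [[H GH DG]|[nG DG]] := Dop_forest_poly_at G j.
    exists << c *g H >>; first by rewrite DU DG mmapU mulrCA.
    move=> F H' FH'; rewrite !mcoeffU; congr (_ *+ nat_of_bool _).
    apply/eqP/eqP => [eH|eG]; first by subst H'; apply: prunes_inj GH FH'.
    by subst F; apply: prunes_fun GH FH'.
  exists 0; first by rewrite DU DG raddf0 !mulr0.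
  move=> F H FH; rewrite mcoeff0 mcoeffU; case: eqP => // eG.
  by subst F; case: (nG H).
Qed.

(** Linear independence of the forest polynomials. *)
Lemma E_eq0_coeff a G : E a = 0 -> a@_G = 0.
Proof.
elim/prunes_ind: G a => [|G j H GH IH] a Ea0; first by rewrite -ev_E Ea0 rmorph0.
have [a' DE a'P] := Dop_E j a; rewrite -(a'P _ _ GH); apply: IH.
by apply: (@x_reg j); rewrite -DE Ea0 /Dop !rmorph0 subrr.
Qed.

(** Trimming stays within the family of the R_i P_F: in the one case where T_j
    R_i is a sum, [prunes_succ] makes one of the terms vanish on P_F. *)
Lemma Dop_R_forest_poly_at i j F :
  (exists i' F', D j (R i (P F)) = x j * R i' (P F')) \/ D j (R i (P F)) = 0.
Proof.
have [le_ij|lt_ji] := leqP i j.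
  rewrite Dop_R_ge //.
  have [[H _ ->]|[_ ->]] := Dop_forest_poly_at F j.+1; last by right; rewrite rmorph0.
  by left; exists i, H; rewrite rmorphM R_gt.
case: i lt_ji => // i; rewrite ltnS leq_eqVlt => /orP[/eqP<-|lt_ji].
  rewrite Dop_R_eq.
  have [[H FH ->]|[_ ->]] := Dop_forest_poly_at F j.
    have [[H' FH' _]|[_ ->]] := Dop_forest_poly_at F j.+1.
      by case: (prunes_succ FH FH').
    by left; exists j.+1, H; rewrite rmorphM R_lt // rmorph0 addr0.
  have [[H _ ->]|[_ ->]] := Dop_forest_poly_at F j.+1; last first.
    by right; rewrite !rmorph0 addr0.
  by left; exists j, H; rewrite rmorphM R_gt // rmorph0 add0r.
rewrite Dop_R_lt //.
have [[H _ ->]|[_ ->]] := Dop_forest_poly_at F j; last by right; rewrite rmorph0.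
by left; exists i, H; rewrite rmorphM R_lt.
Qed.

(** The coefficient at [G] is read off by repeated trimming, which ends with
    the constant term of some R_i' P_F', or with 0. *)
Lemma R_forest_poly_at_coeff i F a G : E a = R i (P F) -> a@_G \in [:: 0; 1].
Proof.
elim/prunes_ind: G i F a => [|G j H GH IH] i F a EaE.
  by rewrite -ev_E EaE ev_R ev_forest_poly_at; case: eqP.
have [a' DE a'P] := Dop_E j a; rewrite -(a'P _ _ GH).
have [[i' [F' DR]]|DR] := Dop_R_forest_poly_at i j F; rewrite -EaE DE in DR.
  apply: (IH i' F'); apply/eqP; rewrite -subr_eq0; apply/eqP.
  by apply: (@x_reg j); rewrite mulrBr DR subrr.
by rewrite (E_eq0_coeff _ (x_reg DR)).
Qed.

End ShiftOperators.

(** * Forest polynomials span the polynomial ring *)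

(** Passing to the left child preserves rho and passing to the right child
    increases it, so rho is itself a compatible labelling. *)
Lemma admissible_left_rank p m t :
  (m <= p)%N -> admissible p m t (fun a => p + left_rank t a)%N.
Proof.
elim: t p m => // l IHl r IHr p m le_mp /=.
rewrite left_rank_nil addn0 le_mp leqnn /=.
apply/andP; split.
  rewrite (@eq_admissible _ _ _ _ (fun a => p + left_rank l a)%N) ?IHl //.
  by move=> a _; rewrite left_rank_false.
rewrite (@eq_admissible _ _ _ _ (fun a => p + nleaves l + left_rank r a)%N).
  by rewrite IHr //; have := nleaves_gt0 l; lia.
by move=> a _; rewrite left_rank_true addnA.
Qed.

Lemma sumn_map_lt (T : eqType) (s : seq T) (f g : T -> nat) :
  {in s, forall v, (f v <= g v)%N} -> map f s != map g s ->
  (sumn (map f s) < sumn (map g s))%N.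
Proof.
elim: s => //= v s IHs le_fg; rewrite eqseq_cons negb_and.
have le_v : (f v <= g v)%N by rewrite le_fg ?mem_head.
have le_s : {in s, forall v, (f v <= g v)%N}.
  by move=> u u_s; rewrite le_fg // inE u_s orbT.
have [eq_s|ne_s] := eqVneq (map f s) (map g s).
  by rewrite eq_s orbF; lia.
by move=> _; have := IHs le_s ne_s; lia.
Qed.

(** The values of rho on a tree whose leftmost leaf is the leaf [p]. *)
Definition tree_code p t := [seq p + left_rank t a | a <- inodes t]%N.

Lemma tree_code_Node p l r :
  tree_code p (Node l r) = p :: tree_code p l ++ tree_code (p + nleaves l) r.
Proof.
rewrite /tree_code /= left_rank_nil addn0 map_cat -!map_comp.
congr (_ :: _ ++ _); apply: eq_map => a /=; rewrite ?left_rank_false //.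
by rewrite left_rank_true addnA.
Qed.

Fixpoint code (p : nat) (L : seq bintree) : seq nat :=
  if L is t :: L' then tree_code p t ++ code (p + nleaves t) L' else [::].

Lemma code_cons p t L :
  code p (t :: L) = tree_code p t ++ code (p + nleaves t) L.
Proof. by []. Qed.

Lemma code_rcons p L t :
  code p (rcons L t) = code p L ++ tree_code (p + sumn (map nleaves L)) t.
Proof.
elim: L p => [|u L IHL] p /=; first by rewrite addn0 cats0.
by rewrite IHL catA addnA.
Qed.

Lemma code_nseq p k L : code p (nseq k Leaf ++ L) = code (p + k) L.
Proof.
elim: k p => [|k IHk] p /=; first by rewrite addn0.
by rewrite IHk nleaves_Leaf addn1 addSnnS.
Qed.

Definition seq_forest (L : seq bintree) : forest :=
  [fsfun n in seq_fset tt (iota 0 (size L)) => nth Leaf L n].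

Lemma seq_forestE L n : seq_forest L n = nth Leaf L n.
Proof.
rewrite fsfunE; case: ifP => //; rewrite seq_fsetE mem_iota /= add0n ltnNge.
by move/negbFE => le_n; rewrite nth_default.
Qed.

Lemma code_seq_forest L :
  map (rho (seq_forest L)) (nodes (seq_forest L) (size L)) = code 0 L.
Proof.
set F := seq_forest L; rewrite -[in RHS](take_size L).
suff main n : (n <= size L)%N -> map (rho F) (nodes F n) = code 0 (take n L) /\
    offset F n = sumn (map nleaves (take n L)) by have [] := main _ (leqnn _).
elim: n => [|n IHn] lt_n; first by rewrite take0 offset0.
have [codeE offE] := IHn (ltnW lt_n).
rewrite (take_nth Leaf lt_n) code_rcons map_rcons sumn_rcons offsetS.
rewrite -offE /= map_cat codeE -map_comp /F seq_forestE; split=> //.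
by congr (_ ++ _); apply: eq_map => a; rewrite /= rhoE seq_forestE.
Qed.

(** The prescribed values are treated from the largest to the smallest: a
    value [y] is realized by joining the tree that starts at the leaf [y] and
    its right neighbour under a new root, whose left branch ends in [y].  All
    values realized so far are at least [y], so the leaves before [y] are free
    and the list of trees can be taken to start there. *)
Lemma exists_code p s : path leq p s -> exists L, perm_eq (code p L) s.
Proof.
elim: s p => [|y s IHs] p /=; first by exists [::].
case/andP=> le_py /IHs[L codeL].
(* The list may be too short, in which case it is padded with single leaves. *)
pose a := nth Leaf L 0; pose b := nth Leaf L 1.
exists (nseq (y - p) Leaf ++ Node a b :: drop 2 L).
rewrite code_nseq subnKC // code_cons tree_code_Node cat_cons perm_cons.
suff <- : code y L = (tree_code y a ++ tree_code (y + nleaves a) b)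
    ++ code (y + nleaves (Node a b)) (drop 2 L) by [].
rewrite /a /b nleaves_Node addnA -catA.
by case: (L) => [|t [|u L']] //=; rewrite ?drop0 ?cats0.
Qed.

(** Triangularity: [s] is the list of values of rho on a suitable forest, and
    any other compatible labelling is pointwise below rho. *)
Lemma forest_poly_at_lead (A : comNzRingType) (x : nat -> A) s : exists F,
  exists2 T : seq (seq nat),
    forest_poly_at x F = \prod_(k <- s) x k + \sum_(y <- T) \prod_(k <- y) x k &
    forall y, y \in T -> (sumn y < sumn s)%N.
Proof.
have [|L] := @exists_code 0 (sort leq s).
  by rewrite path_min_sorted ?(sort_sorted leq_total) //; apply/allP.
rewrite -code_seq_forest; set F := seq_forest L; set y0 := map _ _ => perm_y0.
have perm_s : perm_eq y0 s by rewrite (perm_trans perm_y0) // perm_sort.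
have FN : supported F (size L).
  by move=> n le_n; rewrite seq_forestE nth_default.
exists F, (filter (predC1 y0) (forest_labellings F (size L))).
  rewrite (forest_poly_atE x FN) -sum_forest_labellings.
  rewrite (bigD1_seq y0) ?uniq_forest_labellings //=.
    by rewrite (perm_big _ perm_s) big_filter.
  apply/forest_labellingsP; exists (rho F) => // n _.
  exact: admissible_left_rank.
move=> y; rewrite mem_filter => /andP[/= ne_y /forest_labellingsP[f yE ok]].
rewrite -(perm_sumn perm_s) yE; apply: sumn_map_lt; last by rewrite -yE.
move=> -[n a]; rewrite mem_nodes in_IN /= => /andP[lt_n a_n].
by have /admissibleP[_ /(_ _ a_n)[]] := ok n lt_n.
Qed.

Local Notation E := (mmap (intmul (1 : Pol)) (forest_poly_at X)).

(** Induction on the sum of the indices in a monomial, by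
    [forest_poly_at_lead]. *)
Lemma exists_expansion f : exists a : {malg int[forest]}, E a = f.
Proof.
have ED f1 f2 : (exists a, E a = f1) -> (exists a, E a = f2) ->
    exists a, E a = f1 + f2.
  by move=> [a <-] [b <-]; exists (a + b); rewrite raddfD.
elim/Pol_ind: f => [|f g|c f [a <-]|s].
- by exists 0; rewrite raddf0.
- exact: ED.
- by exists (a *~ c); rewrite raddfMz -scaler_int intz.
have [d] := ubnP (sumn s); elim: d s => // d IHd s; rewrite ltnS => le_d.
have [F [T PF lt_T]] := forest_poly_at_lead X s.
have [b bE] : exists a, E a = \sum_(y <- T) xprod y.
  rewrite big_seq; elim/big_ind: _ => [|//|y y_T].
    by exists 0; rewrite raddf0.
  by apply: IHd; apply: leq_trans (lt_T y y_T) le_d.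
exists (<< F >> - b); transitivity (E << F >> - E b); first exact: raddfB.
have -> : E << F >> = forest_poly_at X F by rewrite mmapU mul1r.
by rewrite bE PF addrK.
Qed.

Theorem proposition7p2 (F : forest) (i : nat) :
  multiplicity_free_forest_positive (Rop i (forest_poly F)).
Proof.
have [a aE] := exists_expansion (Rop i (forest_poly F)).
exists a.
  rewrite /forest_expansion -[LHS]aE mmapE; apply: eq_bigr => G _.
  by rewrite -mul_malgC -[in RHS](intz a@_G) rmorph_int.
move=> G.
exact: (R_forest_poly_at_coeff RopX_lt RopX_eq RopX_gt Rop_comp mulX_eq0
          ev0X ev0_Rop G aE).
Qed.
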